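(* Consider two samples $X_i(t)=\mu(t)+\varepsilon_i(t)$, $1\le i\le N$, and $X^*_j(t)=\mu^*(t)+\varepsilon^*_j(t)$, $1\le j\le M$, $t\in[0,1]$, with $\mu,\mu^*\in L^2([0,1])$. Suppose $(\varepsilon_i)$ satisfies: $\varepsilon_i=f(\delta_i,\delta_{i-1},\ldots)$ with $(\delta_i)$ i.i.d. in a measurable space $S$ and $f:S^\infty\to L^2$ measurable; $\sum_{m\ge1}(E\int_0^1(\varepsilon_i(t)-\varepsilon_{i,m}(t))^2dt)^{1/2}<\infty$, where $\varepsilon_{i,m}=f(\delta_i,\ldots,\delta_{i-m+1},\delta^{(m)}_{i,i-m},\delta^{(m)}_{i,i-m-1},\ldots)$ with $(\delta^{(m)}_{i,k})_k$ independent copies of $(\delta_k)$; $E\varepsilon_0=0$ in $L^2$; $\int_0^1E\varepsilon_0^2(t)dt<\infty$. Suppose $(\varepsilon^*_j)$ satisfies the same conditions. Suppose $\{\varepsilon_i,1\le i\le N\}$ and $\{\varepsilon^*_j,1\le j\le M\}$ are independent, that $H_A:\mu\ne\mu^*$ (i.e. $\int_0^1(\mu-\mu^* )^2dt>0$) holds, and that $N/(N+M)\to\theta$ for some $0\le\theta\le1$ as $\min(M,N)\to\infty$. With $\bar X_N=N^{-1}\sum_{i=1}^NX_i$, $\bar X^*_M=M^{-1}\sum_{j=1}^MX^*_j$ and $U_{N,M}=\frac{NM}{N+M}\int_0^1(\bar X_N(t)-\bar X^*_M(t))^2dt$, we have $$\frac{N+M}{NM}U_{N,M}\to\int_0^1(\mu(t)-\mu^*(t))^2dt\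 \text{ in probability}.$$ In particular, if $0<\theta<1$, then $U_{N,M}\to\infty$ in probability.
   Context: $L^2=L^2([0,1])$; limits are as $\min(M,N)\to\infty$. *)

(* Defs.v *)
From HB Require Import structures.
From mathcomp Require Import all_boot all_order all_algebra.
From mathcomp Require Import all_classical all_reals all_analysis.
Set Implicit Arguments. Unset Strict Implicit. Unset Printing Implicit Defensive.
Import Order.TTheory GRing.Theory Num.Theory.
Import numFieldNormedType.Exports.
Local Open Scope classical_set_scope.
Local Open Scope ring_scope.

Definition int01 {R : realType} (h : R -> \bar R) : \bar R :=
  (\int[@lebesgue_measure R]_(t in `[(0%R:R), (1%R:R)]) h t)%E.

Definition L2fun {R : realType} (g : R -> R) : Prop :=
  measurable_fun `[(0%R:R), (1%R:R)] g /\ (int01 (fun t => ((g t) ^+ 2)%:E) < +oo)%E.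

Definition L2sub (R : realType) := {g : R -> R | L2fun g}.

Definition ip01 {R : realType} (h g : R -> R) : R := fine (int01 (fun t => (h t * g t)%:E)).

Definition mutual_indep {d dS} {Om : measurableType d} {S : measurableType dS}
  {R : realType} (P : probability Om R) {I : eqType} (X : I -> Om -> S) : Prop :=
  (forall i, measurable_fun setT (X i)) /\
  forall (s : seq I) (A : I -> set S), uniq s -> (forall i, measurable (A i)) ->
    P (\big[setI/setT]_(i <- s) (X i @^-1` A i)) =
    (\prod_(i <- s) P (X i @^-1` A i))%E.

Definition iid {d dS} {Om : measurableType d} {S : measurableType dS}
  {R : realType} (P : probability Om R) {I : eqType} (X : I -> Om -> S) : Prop :=
  mutual_indep P X /\
  forall i j (A : set S), measurable A -> P (X i @^-1` A) = P (X j @^-1` A).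

(* Independence of two families of real random variables
   (i.e. of the sigma-algebras they generate). *)
Definition indep_families {d} {Om : measurableType d} {R : realType}
  (P : probability Om R) {I J : Type} (X : I -> Om -> R) (Y : J -> Om -> R) : Prop :=
  forall (s : seq I) (t : seq J) (A : I -> set R) (B : J -> set R),
    (forall i, measurable (A i)) -> (forall j, measurable (B j)) ->
    P (\big[setI/setT]_(i <- s) (X i @^-1` A i) `&`
       \big[setI/setT]_(j <- t) (Y j @^-1` B j)) =
    (P (\big[setI/setT]_(i <- s) (X i @^-1` A i)) *
     P (\big[setI/setT]_(j <- t) (Y j @^-1` B j)))%E.

(* Generators of the product sigma-algebra on S^N x R (cylinder rectangles). *)
Definition cyl_rect {dS} {S : measurableType dS} {R : realType}
  : set (set ((nat -> S) * R)) :=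
  [set C | exists (k : nat) (A : set S) (B : set R), measurable A /\ measurable B /\
      C = (fun p => p.1 k) @^-1` A `&` (fun p => p.2) @^-1` B].

(* f : S^infty -> L^2([0,1]) measurable: realised as a jointly measurable
   kernel (s, t) |-> f s t on S^N x [0,1], with f s in L^2 for every s. *)
Definition shift_measurable {dS} {S : measurableType dS} {R : realType}
  (f : (nat -> S) -> R -> R) : Prop :=
  (forall B : set R, measurable B ->
     <<s cyl_rect >> ([set p | p.2 \in `[(0%R:R), (1%R:R)]] `&` (fun p => f p.1 p.2) @^-1` B))
  /\ forall s, L2fun (f s).

Definition shift_proc {d dS} {Om : measurableType d} {S : measurableType dS}
  {R : realType} (delta : int -> Om -> S) (f : (nat -> S) -> R -> R)
  (i : int) (w : Om) : R -> R :=
  f (fun k : nat => delta (i - k%:Z) w).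

Definition shift_proc_m {d dS} {Om : measurableType d} {S : measurableType dS}
  {R : realType} (delta : int -> Om -> S) (deltac : nat -> int -> int -> Om -> S)
  (f : (nat -> S) -> R -> R) (m : nat) (i : int) (w : Om) : R -> R :=
  f (fun k : nat => if (k < m)%N then delta (i - k%:Z) w
                    else deltac m i (i - k%:Z) w).

(* The assumptions on an error sequence (Bernoulli shift, L^2-m-approximability,
   mean zero, finite second moment). [deltac m i] is the independent copy
   (delta^(m)_{i,k})_k of (delta_k)_k used to build eps_{i,m}. *)
Definition error_assumptions {d dS} {Om : measurableType d} {S : measurableType dS}
  {R : realType} (P : probability Om R) (delta : int -> Om -> S)
  (deltac : nat -> int -> int -> Om -> S) (f : (nat -> S) -> R -> R) : Prop :=
  [/\ iid P delta,
   (forall (m : nat) (i : int), (0 < m)%N ->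
      iid P (fun k : int + int => match k with
                                  | inl k => delta k
                                  | inr k => deltac m i k end)),
   shift_measurable f &
   [/\ (forall i : int,
      (\sum_(1 <= m <oo)
         sqrte (\int[P]_w int01 (fun t =>
            ((shift_proc delta f i w t - shift_proc_m delta deltac f m i w t) ^+ 2)%:E))
       < +oo)%E),
   (forall g : R -> R, L2fun g ->
      (\int[P]_w (ip01 (shift_proc delta f 0 w) g)%:E)%E = 0%E) &
   (int01 (fun t => \int[P]_w ((shift_proc delta f 0 w t) ^+ 2)%:E) < +oo)%E ] ].

Definition sample_mean {d} {Om : measurableType d} {R : realType}
  (mu : R -> R) (eps : int -> Om -> R -> R) (N : nat) (w : Om) (t : R) : R :=
  (N%:R)^-1 * \sum_(1 <= i < N.+1) (mu t + eps i%:Z w t).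

(* Main.v *)
Require Import Defs.
From HB Require Import structures.
From mathcomp Require Import all_boot all_order all_algebra.
From mathcomp Require Import all_classical all_reals all_analysis.
From mathcomp Require Import measurable_realfun.
From mathcomp Require Import ring lra zify.
Import Order.TTheory GRing.Theory Num.Theory.
Import numFieldNormedType.Exports.
Set Implicit Arguments.
Unset Strict Implicit.
Unset Printing Implicit Defensive.
Local Open Scope classical_set_scope.
Local Open Scope ring_scope.

(** All processes are viewed in L^2 of Om x [0,1] with the product of P and the
    uniform law (functions of t are extended by 0 outside [0,1]).

    The finite cylinders form a pi-system, hence an i.i.d. family has a unique
    law, whatever probability space carries it. This gives the stationarity of
    (eps_i, eps_{i,m}). It also shows that eps_i and eps_{i+m,m}, being built
    from disjoint sets of innovations, are jointly distributed as two
    independent copies of eps_0 realised on Om x Om; by Fubini and E eps_0 = 0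
    they are orthogonal. So
      |<eps_i, eps_{i+m}>| = |<eps_i, eps_{i+m} - eps_{i+m,m}>|
                          <= ||eps_0|| ||eps_0 - eps_{0,m}||
    by the Cauchy-Schwarz inequality, and the summability of the last factor
    yields ||eps_1 + ... + eps_N||^2 = O(N). Hence the error means tend to 0 in
    L^2, and Markov's inequality gives the first limit. The second one follows
    because NM/(N+M), the inverse of 1/N + 1/M, tends to infinity. *)

(** * Laws of i.i.d. families *)

Definition eq_law {d1 d2 d : measure_display} {T1 : measurableType d1}
    {T2 : measurableType d2} {T : measurableType d} {R : realType}
    (mu1 : {measure set T1 -> \bar R}) (phi1 : T1 -> T)
    (mu2 : {measure set T2 -> \bar R}) (phi2 : T2 -> T) : Prop :=
  [/\ measurable_fun setT phi1, measurable_fun setT phi2 &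
      forall C, measurable C -> mu1 (phi1 @^-1` C) = mu2 (phi2 @^-1` C)].

Section eq_law_theory.
Context {d1 d2 d3 d d' dV : measure_display} {T1 : measurableType d1}
  {T2 : measurableType d2} {T3 : measurableType d3} {T : measurableType d}
  {T' : measurableType d'} {V : measurableType dV} {R : realType}.
Variables (mu1 : {measure set T1 -> \bar R}) (phi1 : T1 -> T)
  (mu2 : {measure set T2 -> \bar R}) (phi2 : T2 -> T)
  (mu3 : {measure set T3 -> \bar R}) (phi3 : T3 -> T).

Lemma eq_law_sym : eq_law mu1 phi1 mu2 phi2 -> eq_law mu2 phi2 mu1 phi1.
Proof. by move=> [mphi1 mphi2 eqC]; split=> // C mC; rewrite eqC. Qed.

Lemma eq_law_trans : eq_law mu1 phi1 mu2 phi2 -> eq_law mu2 phi2 mu3 phi3 ->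
  eq_law mu1 phi1 mu3 phi3.
Proof. by move=> [m1 _ E12] [_ m3 E23]; split=> // C mC; rewrite E12 ?E23. Qed.

Lemma eq_law_comp (psi : T -> T') : measurable_fun setT psi ->
  eq_law mu1 phi1 mu2 phi2 -> eq_law mu1 (psi \o phi1) mu2 (psi \o phi2).
Proof.
move=> mpsi [mphi1 mphi2 eqC]; split; [exact: measurableT_comp..|].
move=> C mC; apply: (eqC (psi @^-1` C)).
by rewrite -[_ @^-1` _]setTI; exact: mpsi.
Qed.

Lemma eq_law_integral (G : T -> \bar R) : eq_law mu1 phi1 mu2 phi2 ->
  measurable_fun setT G -> (\int[mu1]_x G (phi1 x) = \int[mu2]_x G (phi2 x))%E.
Proof.
move=> [mphi1 mphi2 eqC] mG.
have ge0_eq (H : T -> \bar R) : measurable_fun setT H ->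
    (forall y, 0 <= H y)%E ->
    (\int[mu1]_x (H \o phi1) x = \int[mu2]_x (H \o phi2) x)%E.
  move=> mH H0.
  have /= push1 := ge0_integral_pushforward mphi1 mu1 measurableT mH
    (fun y _ => H0 y).
  have /= push2 := ge0_integral_pushforward mphi2 mu2 measurableT mH
    (fun y _ => H0 y).
  rewrite preimage_setT in push1; rewrite preimage_setT in push2.
  rewrite -push1 -push2.
  by apply: eq_measure_integral => //= C mC _; exact: eqC.
rewrite -[fun x => G (phi1 x)]/(G \o phi1) -[fun x => G (phi2 x)]/(G \o phi2).
rewrite [LHS]integralE [RHS]integralE; congr (_ - _)%E.
  rewrite (funepos_comp G phi1) (funepos_comp G phi2).
  by apply: ge0_eq => //; exact: measurable_funepos.
rewrite (funeneg_comp G phi1) (funeneg_comp G phi2).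
by apply: ge0_eq => //; exact: measurable_funeneg.
Qed.

Lemma eq_law_prod (nu : {sigma_finite_measure set V -> \bar R}) :
  eq_law mu1 phi1 mu2 phi2 ->
  eq_law (mu1 \x nu)%E (fun p => (phi1 p.1, p.2))
         (mu2 \x nu)%E (fun p => (phi2 p.1, p.2)).
Proof.
move=> law; have [mphi1 mphi2 _] := law.
have mpair (d0 : measure_display) (T0 : measurableType d0) (phi : T0 -> T) :
    measurable_fun setT phi ->
    measurable_fun setT (fun p : T0 * V => (phi p.1, p.2)).
  by move=> mphi; apply: measurable_fun_pair => //; exact: measurableT_comp.
split => [||C mC]; [exact: mpair|exact: mpair|].
transitivity (\int[mu1]_x nu (xsection C (phi1 x)))%E.
  by apply: eq_integral => x _; rewrite /= !xsectionE.
rewrite (eq_law_integral law (measurable_fun_xsection nu mC)).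
by apply: eq_integral => x _; rewrite /= !xsectionE.
Qed.

End eq_law_theory.

Section eq_law_projections.
Context {d1 d2 : measure_display} {T1 : measurableType d1}
  {T2 : measurableType d2} {R : realType}.
Variables (P1 : probability T1 R) (P2 : probability T2 R).

Lemma eq_law_fst : eq_law (P1 \x P2)%E fst P1 id.
Proof.
split=> // C mC; have -> : fst @^-1` C = C `*` [set: T2].
  by apply/seteqP; split=> -[? ?] //= [].
by rewrite [LHS]product_measure1E// [X in (_ * X)%E]probability_setT mule1.
Qed.

Lemma eq_law_snd : eq_law (P1 \x P2)%E snd P2 id.
Proof.
split=> // C mC; have -> : snd @^-1` C = [set: T1] `*` C.
  by apply/seteqP; split=> -[? ?] //= [].
by rewrite [LHS]product_measure1E// [X in (X * _)%E]probability_setT mul1e.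
Qed.

End eq_law_projections.

Section path_space.
Context {dS : measure_display} (K : choiceType) (S : measurableType dS).

Definition cylinders : set (set (K -> S)) :=
  [set C | exists (s : seq K) (A : K -> set S), (forall k, measurable (A k)) /\
     C = [set x | forall k, k \in s -> A k (x k)]].

Definition pathspace := g_sigma_algebraType cylinders.

Lemma setI_closed_cylinders : setI_closed cylinders.
Proof.
move=> _ _ [s1 [A1 [mA1 ->]]] [s2 [A2 [mA2 ->]]].
exists (s1 ++ s2), (fun k => (if k \in s1 then A1 k else setT) `&`
  (if k \in s2 then A2 k else setT)); split.
  by move=> k; apply: measurableI; case: ifP.
apply/seteqP; split=> x /=.
  move=> [x1 x2] k _.
  by split; case: ifPn => // ks; [exact: x1|exact: x2].
move=> x12; split=> k ks.
  by have := x12 k; rewrite mem_cat ks => /(_ isT)[].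
by have := x12 k; rewrite mem_cat ks orbT => /(_ isT)[].
Qed.

Lemma measurable_coord (k : K) : measurable_fun setT (fun x : pathspace => x k).
Proof.
move=> _ A mA; rewrite setTI; apply: sub_sigma_algebra.
exists [:: k], (fun=> A); split=> //; apply/seteqP; split=> x /=.
  by move=> Axk j; rewrite inE => /eqP ->.
by apply; rewrite inE.
Qed.

Lemma preimage_cylinder (T : Type) (X : K -> T -> S) (s : seq K)
    (A : K -> set S) :
  (fun w => X ^~ w) @^-1` [set x | forall k, k \in s -> A k (x k)] =
  \big[setI/setT]_(k <- s) (X k @^-1` A k).
Proof. by rewrite -bigcap_seq. Qed.

Lemma measurable_path (d : measure_display) (T : measurableType d)
    (X : K -> T -> S) : (forall k, measurable_fun setT (X k)) ->
  measurable_fun setT (fun w => X ^~ w : pathspace).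
Proof.
move=> mX; apply: (@measurability _ _ _ pathspace _ _ cylinders) => //.
move=> _ [_ [s [A [mA ->]]] <-]; rewrite setTI preimage_cylinder.
apply: bigsetI_measurable => k _.
by rewrite -(setTI (_ @^-1` _)); exact: mX.
Qed.

End path_space.

Lemma iid_cylinder {d dS : measure_display} {Om : measurableType d}
    {S : measurableType dS} {R : realType} {K : choiceType}
    (P : probability Om R) (X : K -> Om -> S) (s : seq K) (A : K -> set S) :
  iid P X -> (forall k, measurable (A k)) ->
  P ((fun w => X ^~ w) @^-1` [set x | forall k, k \in s -> A k (x k)]) =
  (\prod_(k <- undup s) P (X k @^-1` A k))%E.
Proof.
move=> iidX mA; rewrite preimage_cylinder -(big_undup _ _ _ (@setIid _)).
by rewrite iidX.1.2 ?undup_uniq.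
Qed.

Lemma iid_eq_law {d1 d2 dS : measure_display} {Om1 : measurableType d1}
    {Om2 : measurableType d2} {S : measurableType dS} {R : realType}
    {K : choiceType} (P1 : probability Om1 R) (P2 : probability Om2 R)
    (X1 : K -> Om1 -> S) (X2 : K -> Om2 -> S) :
  iid P1 X1 -> iid P2 X2 -> (forall k, eq_law P1 (X1 k) P2 (X2 k)) ->
  eq_law P1 (fun w => X1 ^~ w : pathspace K S) P2 (fun w => X2 ^~ w).
Proof.
move=> iidX1 iidX2 eqX; split=> [||C mC];
  [exact/measurable_path/iidX1.1.1|exact/measurable_path/iidX2.1.1|].
apply: (@measure_unique _ R (pathspace K S) (@cylinders _ K S) (fun=> setT)
  _ _ _ _ (pushforward P1 (fun w => X1 ^~ w : pathspace K S))
  (pushforward P2 (fun w => X2 ^~ w : pathspace K S))) => //.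
- exact: setI_closed_cylinders.
- by exists [::], (fun=> setT); split=> //; apply/seteqP; split.
- by rewrite bigcup_const.
- exact: measurable_path iidX1.1.1.
- exact: measurable_path iidX2.1.1.
- move=> ? ? _ [s [A [mA ->]]].
  apply: etrans (iid_cylinder s iidX1 mA) _.
  apply: etrans (esym (iid_cylinder s iidX2 mA)).
  by apply: eq_bigr => k _; have [_ _] := eqX k; apply.
- by move=> ? _; rewrite [ltLHS](probability_setT P1) ltry.
Qed.

Section iid_families.
Context {d dS : measure_display} {Om : measurableType d} {S : measurableType dS}
  {R : realType} (P : probability Om R).

Lemma iid_eq_marginal (I : eqType) (X : I -> Om -> S) i j :
  iid P X -> eq_law P (X i) P (X j).
Proof. by case=> [[mX _] idX]; split=> // A mA; exact: idX. Qed.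

Lemma iid_reindex (I : eqType) (J : choiceType) (h : J -> I)
    (X : I -> Om -> S) :
  injective h -> iid P X -> iid P (X \o h).
Proof.
move=> h_inj [[mX indX] idX]; split; [split|] => [j|s A us mA|i j A mA].
- exact: mX.
- pose Ah i := if [pick j : seq_sub s | h (val j) == i] is Some j
               then A (val j) else setT.
  have AhE j : j \in s -> Ah (h j) = A j.
    move=> js; rewrite /Ah.
    case: pickP => [k /eqP/h_inj <- //|/(_ (SeqSub js))].
    by rewrite /= eqxx.
  have mAh i : measurable (Ah i) by rewrite /Ah; case: pickP.
  have := indX (map h s) Ah; rewrite map_inj_uniq// => /(_ us mAh).
  rewrite !big_map [X in P X = _]big_seq [X in _ = X -> _]big_seq => PAh.
  rewrite big_seq [RHS]big_seq.
  under eq_bigr do rewrite -AhE//.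
  by under [RHS]eq_bigr do rewrite -AhE//.
- exact: idX.
Qed.

End iid_families.

Section sum_family.
Context {d1 d2 dS : measure_display} {Om1 : measurableType d1}
  {Om2 : measurableType d2} {S : measurableType dS} {R : realType}.
Variables (K1 K2 : eqType) (P1 : probability Om1 R) (P2 : probability Om2 R).
Variables (X1 : K1 -> Om1 -> S) (X2 : K2 -> Om2 -> S).

Definition sum_family (k : K1 + K2) (w : Om1 * Om2) : S :=
  match k with inl k1 => X1 k1 w.1 | inr k2 => X2 k2 w.2 end.

Hypotheses (iidX1 : iid P1 X1) (iidX2 : iid P2 X2).
Hypothesis eqX : forall k1 k2, eq_law P1 (X1 k1) P2 (X2 k2).

Lemma eq_law_sum_family_inl k1 :
  eq_law (P1 \x P2)%E (sum_family (inl k1)) P1 (X1 k1).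
Proof. exact: (eq_law_comp (iidX1.1.1 k1) (eq_law_fst P1 P2)). Qed.

Lemma eq_law_sum_family_inr k2 :
  eq_law (P1 \x P2)%E (sum_family (inr k2)) P2 (X2 k2).
Proof. exact: (eq_law_comp (iidX2.1.1 k2) (eq_law_snd P1 P2)). Qed.

Let lefts (s : seq (K1 + K2)) :=
  pmap (fun k => if k is inl k1 then Some k1 else None) s.
Let rights (s : seq (K1 + K2)) :=
  pmap (fun k => if k is inr k2 then Some k2 else None) s.

Lemma preimage_sum_family (s : seq (K1 + K2)) (A : K1 + K2 -> set S) :
  \big[setI/setT]_(k <- s) (sum_family k @^-1` A k) =
  \big[setI/setT]_(k <- lefts s) (X1 k @^-1` A (inl k)) `*`
  \big[setI/setT]_(k <- rights s) (X2 k @^-1` A (inr k)).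
Proof.
elim: s => [|[k|k] s IH] /=; first by rewrite !big_nil setXTT.
  by rewrite !big_cons IH; apply/seteqP; split=> -[? ?] /= => [[? []]|[[]]].
by rewrite !big_cons IH; apply/seteqP; split=> -[? ?] /= => [[? []]|[? []]].
Qed.

Lemma mutual_indep_sum_family : mutual_indep (P1 \x P2)%E sum_family.
Proof.
split=> [[k|k]|s A us mA].
- by have [] := eq_law_sum_family_inl k.
- by have [] := eq_law_sum_family_inr k.
have uniq_lefts : uniq (lefts s).
  by apply: (@pmap_uniq _ _ _ (inl : K1 -> K1 + K2)) => // -[].
have uniq_rights : uniq (rights s).
  by apply: (@pmap_uniq _ _ _ (inr : K2 -> K1 + K2)) => // -[].
have mpreim (d : measure_display) (Om : measurableType d) (I : eqType)
    (X : I -> Om -> S) (r : seq I) (B : I -> set S) :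
    (forall i, measurable_fun setT (X i)) -> (forall i, measurable (B i)) ->
    measurable (\big[setI/setT]_(i <- r) (X i @^-1` B i)).
  move=> mX mB; apply: bigsetI_measurable => i _.
  by rewrite -[_ @^-1` _]setTI; exact: mX.
rewrite preimage_sum_family [LHS]product_measure1E//; last 2 first.
- exact: mpreim iidX1.1.1 _.
- exact: mpreim iidX2.1.1 _.
have indX1 := iidX1.1.2 _ _ uniq_lefts (fun k => mA (inl k)).
have indX2 := iidX2.1.2 _ _ uniq_rights (fun k => mA (inr k)).
rewrite [X in (X * _)%E]indX1 [X in (_ * X)%E]indX2 {indX1 indX2}.
elim: s {us uniq_lefts uniq_rights} => [|[k|k] s IH] /=.
- by rewrite !big_nil mule1.
- by rewrite !big_cons -IH muleA; have [_ _ ->] := eq_law_sum_family_inl k.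
- by rewrite !big_cons -IH muleCA; have [_ _ ->] := eq_law_sum_family_inr k.
Qed.

Lemma iid_sum_family : iid (P1 \x P2)%E sum_family.
Proof.
split=> [|i j A mA]; first exact: mutual_indep_sum_family.
suff [_ _] : eq_law (P1 \x P2)%E (sum_family i) (P1 \x P2)%E (sum_family j).
  exact.
case: i j => [i|i] [j|j].
- apply: eq_law_trans (eq_law_sum_family_inl i) _.
  apply: eq_law_trans (eq_law_sym (eq_law_sum_family_inl j)).
  exact: iid_eq_marginal.
- apply: eq_law_trans (eq_law_sum_family_inl i) _.
  exact: eq_law_trans (eqX i j) (eq_law_sym (eq_law_sum_family_inr j)).
- apply: eq_law_trans (eq_law_sum_family_inr i) _.
  apply: eq_law_trans (eq_law_sym (eqX j i)) _.
  exact: eq_law_sym (eq_law_sum_family_inl j).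
- apply: eq_law_trans (eq_law_sum_family_inr i) _.
  apply: eq_law_trans (eq_law_sym (eq_law_sum_family_inr j)).
  exact: iid_eq_marginal.
Qed.

End sum_family.

(** * Square-integrable functions *)

Section Lfun2.
Context {d : measure_display} {T : measurableType d} {R : realType}.
Variable mu : {measure set T -> \bar R}.
Implicit Types x y z : T -> R.

Definition Lfun2 : {pred T -> R} := Lfun mu 2%:E.

HB.instance Definition _ :=
  GRing.isSubmodClosed.Build _ _ Lfun2 (Lfun_submod_closed mu (lee1n 2)).

Definition L2dot x y : R := \int[mu]_t (x t * y t).

Definition L2sqnorm x : R := L2dot x x.

Definition L2norm x : R := Num.sqrt (L2sqnorm x).

Lemma Lfun2P x :
  x \in Lfun2 <-> measurable_fun setT x /\ (\int[mu]_t (x t ^+ 2)%:E < +oo)%E.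
Proof.
split=> [x2|[mx xoo]].
  have /andP[/[!inE]/= mx _] := x2; split=> //.
  by move/Lfun2_integrable_sqr/integrable_lty : x2; apply.
rewrite inE; apply/andP; split; rewrite inE//= /finite_norm unlock /Lnorm.
apply: poweR_lty; apply: le_lt_trans xoo.
by under eq_integral do
  rewrite /= powR_mulrn ?normr_ge0// -normrX ger0_norm ?sqr_ge0//.
Qed.

Lemma Lfun2_measurable x : x \in Lfun2 -> measurable_fun setT x.
Proof. by case/Lfun2P. Qed.

Lemma Lfun2_integrableM x y : x \in Lfun2 -> y \in Lfun2 ->
  mu.-integrable setT (fun t => (x t * y t)%:E).
Proof. by move=> x2 y2; exact/Lfun1_integrable/Lfun2_mul_Lfun1. Qed.

Lemma integral_sqr_L2sqnorm x : x \in Lfun2 ->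
  (\int[mu]_t (x t ^+ 2)%:E)%E = (L2sqnorm x)%:E.
Proof.
move=> x2; rewrite /L2sqnorm /L2dot /Rintegral fineK; first exact: eq_integral.
by apply: integrable_fin_num => //; exact: Lfun2_integrableM.
Qed.

Lemma L2dotC x y : L2dot x y = L2dot y x.
Proof. by apply: eq_Rintegral => t _; rewrite mulrC. Qed.

Lemma L2dot0l y : L2dot 0 y = 0.
Proof.
rewrite /L2dot (_ : (fun t => _) = cst 0).
  by rewrite Rintegral_cst// mul0r.
by apply/funext => t; rewrite mul0r.
Qed.

Lemma L2dotDl x y z : x \in Lfun2 -> y \in Lfun2 -> z \in Lfun2 ->
  L2dot (x + y) z = L2dot x z + L2dot y z.
Proof.
move=> x2 y2 z2; rewrite /L2dot -RintegralD//; try exact: Lfun2_integrableM.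
by apply: eq_Rintegral => t _; rewrite mulrDl.
Qed.

Lemma L2dotZl a x y : x \in Lfun2 -> y \in Lfun2 ->
  L2dot (a *: x) y = a * L2dot x y.
Proof.
move=> x2 y2; rewrite /L2dot -RintegralZl//; try exact: Lfun2_integrableM.
by apply: eq_Rintegral => t _; rewrite mulrA.
Qed.

Lemma L2dotBl x y z : x \in Lfun2 -> y \in Lfun2 -> z \in Lfun2 ->
  L2dot (x - y) z = L2dot x z - L2dot y z.
Proof.
by move=> x2 y2 z2; rewrite -scaleN1r L2dotDl ?rpredZ// L2dotZl// mulN1r.
Qed.

Lemma L2dot_suml (I : Type) (s : seq I) (x : I -> T -> R) y :
  (forall i, x i \in Lfun2) -> y \in Lfun2 ->
  L2dot (\sum_(i <- s) x i) y = \sum_(i <- s) L2dot (x i) y.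
Proof.
move=> x2 y2; elim: s => [|i s IH].
  by rewrite !big_nil L2dot0l.
by rewrite !big_cons L2dotDl ?rpred_sum// IH.
Qed.

Lemma L2sqnorm_ge0 x : 0 <= L2sqnorm x.
Proof. by apply: Rintegral_ge0 => t _; rewrite -expr2 sqr_ge0. Qed.

Lemma L2sqnormZ a x : x \in Lfun2 -> L2sqnorm (a *: x) = a ^+ 2 * L2sqnorm x.
Proof.
by move=> x2; rewrite /L2sqnorm L2dotZl ?rpredZ// L2dotC L2dotZl// mulrA.
Qed.

Lemma L2sqnormD x y : x \in Lfun2 -> y \in Lfun2 ->
  L2sqnorm (x + y) = L2sqnorm x + 2 * L2dot x y + L2sqnorm y.
Proof.
move=> x2 y2; rewrite /L2sqnorm L2dotDl ?rpredD//.
rewrite !(L2dotC _ (x + y)) !L2dotDl//.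
by rewrite (L2dotC y x); ring.
Qed.

Lemma L2sqnormB x y : x \in Lfun2 -> y \in Lfun2 ->
  L2sqnorm (x - y) = L2sqnorm x - 2 * L2dot x y + L2sqnorm y.
Proof.
move=> x2 y2; rewrite /L2sqnorm L2dotBl ?rpredB//.
rewrite !(L2dotC _ (x - y)) !L2dotBl//.
by rewrite (L2dotC y x); ring.
Qed.

Lemma L2sqnormB_le x y : x \in Lfun2 -> y \in Lfun2 ->
  L2sqnorm (x - y) <= 2 * (L2sqnorm x + L2sqnorm y).
Proof.
move=> x2 y2; have := L2sqnorm_ge0 (x + y).
by rewrite L2sqnormB// L2sqnormD//; lra.
Qed.

Lemma Lnorm2_L2norm x : x \in Lfun2 ->
  'N[mu]_2%:E[EFin \o x]%E = (L2norm x)%:E.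
Proof.
move=> x2; rewrite -[RHS]/(sqrte (L2sqnorm x)%:E) -integral_sqr_L2sqnorm//.
rewrite unlock /Lnorm poweR12_sqrt; last first.
  by apply: integral_ge0 => t _; rewrite lee_fin powR_ge0.
congr sqrte; apply: eq_integral => t _ /=.
by rewrite powR_mulrn// -normrX ger0_norm ?sqr_ge0.
Qed.

Lemma L2dot_CauchySchwarz x y : x \in Lfun2 -> y \in Lfun2 ->
  `|L2dot x y| <= L2norm x * L2norm y.
Proof.
move=> x2 y2; have xy := Lfun2_integrableM x2 y2.
rewrite -lee_fin EFinM -!Lnorm2_L2norm// EFin_normr_Rintegral//.
apply: le_trans (le_abse_integral _ _ (measurable_int _ xy)) _ => //.
have := hoelder mu (Lfun2_measurable x2) (Lfun2_measurable y2)
  (ltr0n R 2) (ltr0n R 2).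
by rewrite Lnorm1; apply; lra.
Qed.

Lemma L2sqnormD_continuous x e : x \in Lfun2 -> 0 < e ->
  exists2 k, 0 < k & forall y, y \in Lfun2 -> L2sqnorm y < k ->
    `|L2sqnorm (x + y) - L2sqnorm x| <= e.
Proof.
move=> x2 e0; set nx := L2norm x.
have c0 : 0 < 2 * nx + 1 by rewrite ltr_wpDl// mulr_ge0// sqrtr_ge0.
pose r := Num.min 1 (e / (2 * nx + 1)).
have r0 : 0 < r by rewrite lt_min ltr01 divr_gt0.
exists (r ^+ 2) => [|y y2 yr]; first by rewrite exprn_gt0.
set ny := L2norm y.
have ny0 : 0 <= ny by exact: sqrtr_ge0.
have nyE : L2sqnorm y = ny ^+ 2 by rewrite sqr_sqrtr ?L2sqnorm_ge0.
have nyr : ny < r by rewrite -(ltr_pXn2r (ltn0Sn 1)) ?nnegrE ?(ltW r0)// -nyE.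
have {nyr} [ny1 nye] : ny < 1 /\ ny * (2 * nx + 1) < e.
  by move: nyr; rewrite lt_min ltr_pdivlMr// => /andP.
have -> : L2sqnorm (x + y) - L2sqnorm x = 2 * L2dot x y + ny ^+ 2.
  by rewrite L2sqnormD// nyE; ring.
apply: le_trans (ler_normD _ _) _; rewrite normrM ger0_norm//.
rewrite (ger0_norm (sqr_ge0 ny)).
have := L2dot_CauchySchwarz x2 y2; rewrite -/nx -/ny => xy.
by nra.
Qed.

Lemma L2sqnorm_sum_le (x : nat -> T -> R) (s C : R) (g : nat -> R) :
  (forall i, x i \in Lfun2) -> (forall i, L2sqnorm (x i) <= s) ->
  (forall i k, `|L2dot (x i) (x (i + k).+1)| <= g k) ->
  (forall n, \sum_(k < n) g k <= C) ->
  forall N, L2sqnorm (\sum_(i < N) x i) <= N%:R * (s + 2 * C).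
Proof.
move=> x2 xs xg gC; elim=> [|N IH].
  by rewrite big_ord0 /L2sqnorm L2dot0l mul0r.
have sum2 : \sum_(i < N) x i \in Lfun2 by rewrite rpred_sum.
rewrite big_ord_recr/= L2sqnormD// (L2dot_suml _ _ (x2 N))//.
suff : \sum_(i < N) L2dot (x i) (x N) <= C.
  by move=> sumC; rewrite -[N.+1%:R]natr1 mulrDl mul1r; have := xs N; lra.
apply: le_trans (gC N); rewrite (reindex_inj rev_ord_inj)/=.
apply: ler_sum => i _; apply: le_trans (ler_norm _) _.
by have := xg (N - i.+1)%N i; rewrite -addnS subnK.
Qed.

End Lfun2.

Section Lfun2_product.
Context {d1 d2 : measure_display} {T1 : measurableType d1}
  {T2 : measurableType d2} {R : realType}.
Variables (mu1 : {sigma_finite_measure set T1 -> \bar R})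
  (mu2 : {sigma_finite_measure set T2 -> \bar R}).

Lemma integral_L2sqnorm_section (z : T1 * T2 -> R) :
  z \in Lfun2 (mu1 \x mu2)%E ->
  (\int[mu1]_x \int[mu2]_y (z (x, y) ^+ 2)%:E = (L2sqnorm (mu1 \x mu2) z)%:E)%E.
Proof.
move=> z2; rewrite -integral_sqr_L2sqnorm// [RHS]fubini_tonelli1//.
  by apply/measurable_EFinP/measurable_funX; exact: Lfun2_measurable z2.
by move=> p; rewrite lee_fin sqr_ge0.
Qed.

Lemma measurable_L2sqnorm_section (z : T1 * T2 -> R) : measurable_fun setT z ->
  measurable_fun setT (fun x => L2sqnorm mu2 (fun y => z (x, y))).
Proof.
move=> mz; apply: measurableT_comp; first exact: fine_measurable.
have := @measurable_fun_fubini_tonelli_F _ _ _ _ R mu2 (fun p => (z p * z p)%:E).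
apply=> [|p]; last by rewrite lee_fin -expr2 sqr_ge0.
by apply/measurable_EFinP; exact: measurable_funM.
Qed.

End Lfun2_product.

Lemma eq_law_Lfun2 {d1 d2 d : measure_display} {T1 : measurableType d1}
    {T2 : measurableType d2} {T : measurableType d} {R : realType}
    (mu1 : {measure set T1 -> \bar R}) (phi1 : T1 -> T)
    (mu2 : {measure set T2 -> \bar R}) (phi2 : T2 -> T) (x : T -> R) :
  eq_law mu1 phi1 mu2 phi2 -> measurable_fun setT x ->
  x \o phi2 \in Lfun2 mu2 -> x \o phi1 \in Lfun2 mu1.
Proof.
move=> law mx /Lfun2P[_ xoo]; have [mphi1 _ _] := law.
apply/Lfun2P; split; first exact: measurableT_comp.
rewrite (eq_law_integral (G := fun y => (x y ^+ 2)%:E) law)//.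
by apply/measurable_EFinP; exact: measurable_funX.
Qed.

Lemma L2dot_indep_copies {d1 d2 dV : measure_display} {T1 : measurableType d1}
    {T2 : measurableType d2} {V : measurableType dV} {R : realType}
    (P1 : probability T1 R) (P2 : probability T2 R)
    (nu : {sigma_finite_measure set V -> \bar R})
    (x : T1 * V -> R) (y : T2 * V -> R) :
  x \in Lfun2 (P1 \x nu)%E -> y \in Lfun2 (P2 \x nu)%E ->
  (forall w2, \int[P1]_w1 \int[nu]_t (x (w1, t) * y (w2, t))%:E = 0)%E ->
  L2dot ((P1 \x P2) \x nu)%E (fun p => x (p.1.1, p.2))
    (fun p => y (p.1.2, p.2)) = 0.
Proof.
move=> x2 y2 xy0.
have x2_lift : (fun p => x (p.1.1, p.2)) \in Lfun2 ((P1 \x P2) \x nu)%E.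
  have law := eq_law_prod nu (eq_law_fst P1 P2).
  apply: eq_law_Lfun2 law (Lfun2_measurable x2) _.
  by rewrite (_ : _ \o _ = x)//; apply/funext => -[].
have y2_lift : (fun p => y (p.1.2, p.2)) \in Lfun2 ((P1 \x P2) \x nu)%E.
  have law := eq_law_prod nu (eq_law_snd P1 P2).
  apply: eq_law_Lfun2 law (Lfun2_measurable y2) _.
  by rewrite (_ : _ \o _ = y)//; apply/funext => -[].
have ixy := Lfun2_integrableM x2_lift y2_lift.
pose P12 : probability (T1 * T2)%type R := (P1 \x P2)%E.
have iF := @integrable_fubini_F _ _ _ _ R P12 nu _ ixy.
rewrite /L2dot /Rintegral (_ : integral _ _ _ = 0%E)//.
apply: etrans (esym (@integral12_prod_meas1 _ _ _ _ R P12 nu _ ixy)) _.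
apply: etrans (esym (@integral21_prod_meas1 _ _ _ _ R P1 P2 _ iF)) _.
by apply: integral0_eq => w2 _; exact: xy0.
Qed.

(** * Convergence *)

Section cvg_in_measure.
Context {d : measure_display} {T : measurableType d} {R : realType}
  (mu : {measure set T -> \bar R}).
Implicit Types (X Y : nat -> T -> R) (l : R).

Definition cvg_in_measure X l :=
  forall e, 0 < e -> mu [set w | e < `|X n w - l|] @[n --> \oo] --> 0%E.

Lemma measurable_set_ltr (f g : T -> R) : measurable_fun setT f ->
  measurable_fun setT g -> measurable [set w | f w < g w].
Proof.
move=> mf mg; rewrite -[X in measurable X]setTI.
have /(_ measurableT [set true]) := measurable_fun_ltr mf mg; exact.
Qed.

Lemma markov_ge0 (X : T -> R) k : 0 < k ->
  measurable_fun setT X -> (forall w, 0 <= X w) ->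
  (mu [set w | (k <= X w)%R] <= k^-1%:E * \int[mu]_w (X w)%:E)%E.
Proof.
move=> k0 mX X0.
have absX w : `|(X w)%:E|%E = (X w)%:E by rewrite gee0_abs ?lee_fin.
have /measurable_EFinP mXE := mX.
have := @le_integral_comp_abse _ _ _ mu setT measurableT _ k id
  (@measurable_id _ _ _) (fun _ => id) (fun _ _ _ _ => id) mXE k0.
rewrite setTI; under eq_integral do rewrite absX.
under eq_set do rewrite absX lee_fin.
by rewrite -lee_pdivlMl.
Qed.

Lemma cvg_in_measure_dominated X l Y :
  (forall n, measurable_fun setT (X n)) ->
  (forall n, measurable_fun setT (Y n)) -> (forall n w, 0 <= Y n w) ->
  (\int[mu]_w (Y n w)%:E)%E @[n --> \oo] --> 0%E ->
  (forall e, 0 < e -> exists2 k, 0 < k &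
     forall n w, Y n w < k -> `|X n w - l| <= e) ->
  cvg_in_measure X l.
Proof.
move=> mX mY Y0 intY0 XY e e0; have [k k0 Yk] := XY e e0.
apply: (@squeeze_cvge _ _ _ _ (cst 0%E) _
    (fun n => k^-1%:E * \int[mu]_w (Y n w)%:E)%E).
- apply: nearW => n; rewrite measure_ge0/=.
  apply: le_trans (markov_ge0 k0 (mY n) (Y0 n)).
  apply: le_measure; rewrite ?inE.
  + apply: measurable_set_ltr => //.
    by apply: measurableT_comp => //; exact: measurable_funB.
  + by rewrite -[X in measurable X]setTI; apply: measurable_fun_le.
  + by move=> w /= eX; rewrite leNgt; apply/negP => /Yk; rewrite leNgt eX.
- exact: cvg_cst.
- by rewrite -(mule0 k^-1%:E); apply: cvgeZl.
Qed.

Lemma cvg_in_measure_scale_pinfty X l (q : nat -> R) :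
  (forall n, measurable_fun setT (X n)) -> cvg_in_measure X l -> 0 < l ->
  q @ \oo --> +oo ->
  forall K, mu [set w | q n * X n w <= K] @[n --> \oo] --> 0%E.
Proof.
move=> mX Xl l0 qoo K; have l2 : 0 < l / 2 by rewrite divr_gt0.
apply: (@squeeze_cvge _ _ _ _ (cst 0%E) _
    (fun n => mu [set w | l / 3 < `|X n w - l|])).
- have qK : \forall n \near \oo, `|K| / (l / 2) < q n.
    by move/cvgryPgt : qoo; apply.
  apply: filterS qK => n; rewrite ltr_pdivrMr// => qK.
  rewrite measure_ge0/=; apply: le_measure; rewrite ?inE.
  + rewrite -[X in measurable X]setTI; apply: measurable_fun_le => //.
    exact: measurable_funM.
  + apply: measurable_set_ltr => //.
    by apply: measurableT_comp => //; exact: measurable_funB.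
  + move=> w /= qXK; rewrite distrC; apply: lt_le_trans (ler_norm _).
    have q0 : 0 < q n by rewrite -(pmulr_lgt0 _ l2) (le_lt_trans _ qK).
    have : X n w < l / 2.
      by rewrite -(ltr_pM2l q0) (le_lt_trans qXK)// (le_lt_trans (ler_norm K)).
    lra.
- exact: cvg_cst.
- by apply: Xl; rewrite divr_gt0.
Qed.

End cvg_in_measure.

Lemma cvg_in_measure_L2sqnormD {d1 d2 : measure_display}
    {T1 : measurableType d1} {T2 : measurableType d2} {R : realType}
    (mu1 : {sigma_finite_measure set T1 -> \bar R})
    (mu2 : {sigma_finite_measure set T2 -> \bar R})
    (x : T2 -> R) (z : nat -> T1 * T2 -> R) :
  x \in Lfun2 mu2 -> (forall n, z n \in Lfun2 (mu1 \x mu2)%E) ->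
  (forall n w, (fun t => z n (w, t)) \in Lfun2 mu2) ->
  L2sqnorm (mu1 \x mu2)%E (z n) @[n --> \oo] --> (0 : R) ->
  cvg_in_measure mu1
    (fun n w => L2sqnorm mu2 (x + (fun t => z n (w, t)))) (L2sqnorm mu2 x).
Proof.
move=> x2 z2 zw2 z0.
pose Y n w := L2sqnorm mu2 (fun t => z n (w, t)).
apply: (cvg_in_measure_dominated (Y := Y)) => [n|n|n w||e e0].
- apply: (measurable_L2sqnorm_section mu2 (z := fun p => x p.2 + z n p)).
  apply: measurable_funD; last exact: Lfun2_measurable.
  exact: (measurableT_comp (Lfun2_measurable x2) measurable_snd).
- exact: measurable_L2sqnorm_section (Lfun2_measurable (z2 n)).
- exact: L2sqnorm_ge0.
- rewrite (_ : (fun n => _) =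
      EFin \o (fun n => L2sqnorm (mu1 \x mu2)%E (z n))).
    by apply: cvg_EFin => //; exact: nearW.
  apply/funext => n; rewrite /= -integral_L2sqnorm_section//.
  by apply: eq_integral => w _; rewrite integral_sqr_L2sqnorm.
- have [k k0 Yk] := L2sqnormD_continuous x2 e0.
  by exists k => // n w; exact: Yk.
Qed.

Lemma cvg_natr_inv (R : realType) (k : nat -> nat) : k @ \oo --> \oo ->
  (k n)%:R^-1 @[n --> \oo] --> (0 : R).
Proof.
move=> koo; have k_gt0 : \forall n \near \oo, (0 < k n)%N.
  by move/cvgnyPgt : koo; apply.
apply/gtr0_cvgV0; last exact/cvgrnyP.
by apply: filterS k_gt0 => n; rewrite ltr0n.
Qed.

Lemma cvg_minn_infty (N M : nat -> nat) :
  (forall K, \forall n \near \oo, (K <= minn (N n) (M n))%N) ->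
  N @ \oo --> \oo /\ M @ \oo --> \oo.
Proof.
by move=> minNM; split; apply/cvgnyPge => K; have := minNM K;
  apply: filterS => n; rewrite leq_min => /andP[].
Qed.

Lemma cvg_half_harmonic_mean_pinfty (R : realType) (N M : nat -> nat) :
  N @ \oo --> \oo -> M @ \oo --> \oo ->
  ((N n * M n)%:R / (N n + M n)%:R : R) @[n --> \oo] --> +oo.
Proof.
move=> Noo Moo.
have N_gt0 : \forall n \near \oo, (0 < N n)%N by move/cvgnyPgt : Noo; apply.
have M_gt0 : \forall n \near \oo, (0 < M n)%N by move/cvgnyPgt : Moo; apply.
apply/gtr0_cvgV0.
  apply: filterS2 N_gt0 M_gt0 => n N0 M0.
  by rewrite divr_gt0 ?ltr0n ?muln_gt0 ?addn_gt0 ?N0.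
have NMV : \forall n \near \oo,
    (N n)%:R^-1 + (M n)%:R^-1 = ((N n * M n)%:R / (N n + M n)%:R : R)^-1.
  apply: filterS2 N_gt0 M_gt0 => n N0 M0; rewrite invf_div natrD natrM; field.
  by rewrite !pnatr_eq0 -!lt0n N0 M0.
have cvg0 : (N n)%:R^-1 + (M n)%:R^-1 @[n --> \oo] --> (0 : R).
  by rewrite -[X in _ --> X]addr0; apply: cvgD; exact: cvg_natr_inv.
by apply: cvg_trans cvg0; exact: near_eq_cvg.
Qed.

(** * Functions on the unit interval *)

Section unit_interval.
Context {R : realType}.
Implicit Types g h : R -> R.

Definition unif01 : probability (measurableTypeR R) R := uniform_prob (@ltr01 R).

Definition restr01 g : R -> R := g \_ `[0%R, 1%R].

Lemma restr01E g t : restr01 g t = if t \in `[0%R, 1%R]%classic then g t else 0.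
Proof. exact: patchE. Qed.

Lemma restr01D g h : restr01 (g + h) = restr01 g + restr01 h.
Proof.
apply/funext => t; rewrite !fctE !restr01E.
by case: ifP => // _; rewrite addr0.
Qed.

Lemma restr01Z a g : restr01 (a *: g) = a *: restr01 g.
Proof.
apply/funext => t; rewrite !fctE !restr01E.
by case: ifP => // _; rewrite scaler0.
Qed.

Lemma restr01B g h : restr01 (g - h) = restr01 g - restr01 h.
Proof. by rewrite -scaleN1r restr01D restr01Z scaleN1r. Qed.

Lemma restr01_sum (I : Type) (s : seq I) (g : I -> R -> R) :
  restr01 (\sum_(i <- s) g i) = \sum_(i <- s) restr01 (g i).
Proof.
apply: (big_morph _ restr01D).
by apply/funext => t; rewrite restr01E if_same.
Qed.

Lemma restr01M g h : restr01 (g \* h) = restr01 g \* restr01 h.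
Proof.
apply/funext => t; rewrite /= !restr01E.
by case: ifP => // _; rewrite mulr0.
Qed.

Lemma int01_unif01 (h : R -> \bar R) :
  measurable_fun setT (h \_ `[0%R, 1%R]) ->
  int01 h = (\int[unif01]_t (h \_ `[0%R, 1%R]) t)%E.
Proof.
move=> mh; have -> : int01 h = int01 (h \_ `[0%R, 1%R]).
  by apply: eq_integral => t tI; rewrite patchE tI.
rewrite /int01 [LHS]integralE [RHS]integralE !integral_uniform//; last 2 first.
  exact: measurable_funeneg.
  exact: measurable_funepos.
by rewrite subr0 invr1 !mul1e.
Qed.

Lemma int01M g h :
  measurable_fun setT (restr01 g) -> measurable_fun setT (restr01 h) ->
  int01 (fun t => (g t * h t)%:E) =
  (\int[unif01]_t (restr01 g t * restr01 h t)%:E)%E.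
Proof.
move=> mg mh; have restrM : (fun t => (g t * h t)%:E) \_ `[0%R, 1%R] =
    EFin \o (restr01 g \* restr01 h) by rewrite -restr01M -restrict_EFin.
rewrite int01_unif01 restrM//.
by apply/measurable_EFinP; exact: measurable_funM.
Qed.

Lemma Lfun2_restr01 g : L2fun g -> restr01 g \in Lfun2 unif01.
Proof.
move=> [mg goo]; have mrg : measurable_fun setT (restr01 g).
  exact/(measurable_restrictT g).
by apply/Lfun2P; split=> //; rewrite -[ltLHS](int01M mrg mrg).
Qed.

Lemma ip01_unif01 g h : L2fun g -> L2fun h ->
  (ip01 g h)%:E = (\int[unif01]_t (restr01 g t * restr01 h t)%:E)%E.
Proof.
move=> /Lfun2_restr01 g2 /Lfun2_restr01 h2; rewrite /ip01.
rewrite (int01M (Lfun2_measurable g2) (Lfun2_measurable h2)) fineK//.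
by apply: integrable_fin_num => //; exact: Lfun2_integrableM.
Qed.

Lemma int01_sqr_L2sqnorm g : restr01 g \in Lfun2 unif01 ->
  int01 (fun t => (g t ^+ 2)%:E) = (L2sqnorm unif01 (restr01 g))%:E.
Proof.
move=> g2; have mg := Lfun2_measurable g2.
by rewrite -integral_sqr_L2sqnorm// -[RHS](int01M mg mg).
Qed.

End unit_interval.

(** * Bernoulli shifts *)

Lemma measurable_shift_kernel {dS : measure_display} {S : measurableType dS}
    {R : realType} (f : (nat -> S) -> R -> R) :
  shift_measurable f ->
  measurable_fun setT
    (fun p : pathspace nat S * measurableTypeR R => restr01 (f p.1) p.2).
Proof.
set X := (pathspace nat S * measurableTypeR R)%type.
move=> [mf _]; have mI : measurable [set p : X | p.2 \in `[0%R, 1%R]].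
  rewrite (_ : [set p | _] = snd @^-1` `[0%R, 1%R])//.
  by rewrite -[X in measurable X]setTI; exact: measurable_snd.
have cyl_rect_sub : <<s @cyl_rect _ S R >> `<=` @measurable _ X.
  apply: smallest_sub; first exact: sigma_algebra_measurable.
  move=> _ [k [A [B [mA [mB ->]]]]]; apply: measurableI.
    rewrite -[X in measurable X]setTI.
    exact: (measurableT_comp (measurable_coord k) measurable_fst).
  by rewrite -[X in measurable X]setTI; exact: measurable_snd.
have -> : (fun p : X => restr01 (f p.1) p.2) =
    (fun p => f p.1 p.2) \_ [set p : X | p.2 \in `[0%R, 1%R]].
  by apply/funext => p; rewrite restr01E patchE !mem_setE.
by apply/(measurable_restrictT _ mI) => _ B mB; apply: cyl_rect_sub; exact: mf.
Qed.

Definition shift_field {d dS : measure_display} {Om : measurableType d}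
    {S : measurableType dS} {R : realType} (f : (nat -> S) -> R -> R)
    (X : nat -> Om -> S) (p : Om * measurableTypeR R) : R :=
  restr01 (f (X ^~ p.1)) p.2.

Lemma measurable_shift_field {d dS : measure_display} {Om : measurableType d}
    {S : measurableType dS} {R : realType} (f : (nat -> S) -> R -> R)
    (X : nat -> Om -> S) :
  shift_measurable f -> (forall k, measurable_fun setT (X k)) ->
  measurable_fun setT (shift_field f X).
Proof.
move=> mf mX; have mpath : measurable_fun setT
    (fun p : Om * measurableTypeR R => (X ^~ p.1 : pathspace nat S, p.2)).
  apply: measurable_fun_pair => //.
  exact: (measurableT_comp (measurable_path mX) measurable_fst).
exact: (measurableT_comp (measurable_shift_kernel mf) mpath).
Qed.

Section shift_field_law.
Context {d1 d2 dS : measure_display} {Om1 : measurableType d1}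
  {Om2 : measurableType d2} {S : measurableType dS} {R : realType}
  {K : choiceType} (P1 : probability Om1 R) (P2 : probability Om2 R)
  (Z1 : K -> Om1 -> S) (Z2 : K -> Om2 -> S) (f : (nat -> S) -> R -> R).
Hypotheses (mf : shift_measurable f) (iidZ1 : iid P1 Z1) (iidZ2 : iid P2 Z2)
  (eqZ : forall k, eq_law P1 (Z1 k) P2 (Z2 k)).
Implicit Types h : nat -> K.

Lemma integral_shift_fieldM_law h1 h2 :
  (\int[P1 \x unif01]_p
      (shift_field f (Z1 \o h1) p * shift_field f (Z1 \o h2) p)%:E =
   \int[P2 \x unif01]_p
      (shift_field f (Z2 \o h1) p * shift_field f (Z2 \o h2) p)%:E)%E.
Proof.
pose g h := shift_field f (fun i (x : pathspace K S) => x (h i)).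
have mg h : measurable_fun setT (g h).
  by apply: measurable_shift_field => // i; exact: measurable_coord.
apply: (eq_law_integral (G := fun p => (g h1 p * g h2 p)%:E)
  (eq_law_prod unif01 (iid_eq_law iidZ1 iidZ2 eqZ))).
by apply/measurable_EFinP; exact: measurable_funM.
Qed.

Lemma L2dot_shift_field_law h1 h2 :
  L2dot (P1 \x unif01)%E (shift_field f (Z1 \o h1)) (shift_field f (Z1 \o h2)) =
  L2dot (P2 \x unif01)%E (shift_field f (Z2 \o h1)) (shift_field f (Z2 \o h2)).
Proof. by congr fine; exact: integral_shift_fieldM_law. Qed.

Lemma Lfun2_shift_field_law h :
  shift_field f (Z2 \o h) \in Lfun2 (P2 \x unif01)%E ->
  shift_field f (Z1 \o h) \in Lfun2 (P1 \x unif01)%E.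
Proof.
move=> /Lfun2P[_ Z2oo]; apply/Lfun2P; split.
  by apply: measurable_shift_field => // k; exact: iidZ1.1.1.
by rewrite [ltLHS](integral_shift_fieldM_law h h).
Qed.

End shift_field_law.

Section decoupling.
Context {d0 d dS : measure_display} {Om0 : measurableType d0}
  {Om : measurableType d} {S : measurableType dS} {R : realType}
  {K : choiceType} (P0 : probability Om0 R) (P : probability Om R)
  (X : nat -> Om0 -> S) (Z : K -> Om -> S) (f : (nat -> S) -> R -> R).
Hypotheses (mf : shift_measurable f) (iidX : iid P0 X) (iidZ : iid P Z)
  (eqZX : forall k i, eq_law P (Z k) P0 (X i)).
Hypothesis Lfun2_X : shift_field f X \in Lfun2 (P0 \x unif01)%E.
Hypothesis X_mean0 : forall g : R -> R, L2fun g ->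
  (\int[P0]_w (ip01 (f (X ^~ w)) g)%:E)%E = 0%E.

(* By uniqueness of the law, the two shifts may be replaced by independent
   copies of [shift_field f X] living on the two factors of [Om0 * Om0]. *)
Lemma L2dot_shift_field_disjoint (h1 h2 : nat -> K) :
  injective h1 -> injective h2 -> (forall i j, h1 i != h2 j) ->
  L2dot (P \x unif01)%E (shift_field f (Z \o h1)) (shift_field f (Z \o h2)) = 0.
Proof.
move=> h1_inj h2_inj h_disjoint; pose h (k : nat + nat) :=
  match k with inl i => h1 i | inr i => h2 i end.
have h_inj : injective h.
  move=> [i|i] [j|j] /=; [by move=> /h1_inj ->| | |by move=> /h2_inj ->].
    by move/eqP; rewrite (negbTE (h_disjoint i j)).
  by move/esym/eqP; rewrite (negbTE (h_disjoint j i)).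
have eqX i j : eq_law P0 (X i) P0 (X j) by exact: iid_eq_marginal.
have iidXX := iid_sum_family iidX iidX eqX.
have eqZXX k : eq_law P ((Z \o h) k) (P0 \x P0)%E (sum_family X X k).
  case: k => i; apply: eq_law_trans (eqZX _ i) (eq_law_sym _).
    exact: eq_law_sum_family_inl.
  exact: eq_law_sum_family_inr.
have iidZh := iid_reindex h_inj iidZ.
rewrite [LHS](L2dot_shift_field_law mf iidZh iidXX eqZXX inl inr).
apply: (L2dot_indep_copies Lfun2_X Lfun2_X) => w2.
rewrite -[RHS](X_mean0 (mf.2 (X ^~ w2))).
by apply: eq_integral => w1 _; rewrite ip01_unif01//; exact: mf.2.
Qed.

End decoupling.

(** * The error process *)

Definition err01 {d dS : measure_display} {Om : measurableType d}
    {S : measurableType dS} {R : realType} (delta : int -> Om -> S)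
    (f : (nat -> S) -> R -> R) (i : int) : Om * measurableTypeR R -> R :=
  shift_field f (fun k => delta (i - k%:Z)).

Section error_process.
Context {d dS : measure_display} {Om : measurableType d} {S : measurableType dS}
  {R : realType} (P : probability Om R) (delta : int -> Om -> S)
  (deltac : nat -> int -> int -> Om -> S) (f : (nat -> S) -> R -> R).
Hypothesis errP : error_assumptions P delta deltac f.

Let Q : {measure set (Om * measurableTypeR R)%type -> \bar R} :=
  (P \x unif01)%E.
Let err := err01 delta f.

Let mf : shift_measurable f. Proof. by case: errP. Qed.

Let iid_delta : iid P delta. Proof. by case: errP. Qed.

Let past (i : int) (k : nat) : Om -> S := delta (i - k%:Z).

Let iid_past i : iid P (past i).
Proof.
apply: (@iid_reindex _ _ _ _ _ _ _ _ (fun k => i - k%:Z)) iid_delta => a b.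
by lia.
Qed.

Lemma Lfun2_err01_0 : err 0 \in Lfun2 Q.
Proof.
have merr : measurable_fun setT (err 0).
  by apply: measurable_shift_field => // k; exact: iid_delta.1.1.
have merr2 : measurable_fun setT (fun p => (err 0 p ^+ 2)%:E).
  by apply/measurable_EFinP/measurable_funX.
have err2_ge0 p : (0 <= (err 0 p ^+ 2)%:E)%E by rewrite lee_fin sqr_ge0.
apply/Lfun2P; split=> //; rewrite [ltLHS]fubini_tonelli2//.
case: errP => _ _ _ [_ _]; congr (_ < _)%E.
have restr_moment : (fun t => \int[P]_w (shift_proc delta f 0 w t ^+ 2)%:E)%E
    \_ `[0%R, 1%R] = fubini_G P (fun p => (err 0 p ^+ 2)%:E).
  apply/funext => t; rewrite patchE /fubini_G /err /err01 /shift_field.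
  have [tI|tI] := boolP (t \in _); apply/esym.
    by apply: eq_integral => w _; rewrite restr01E tI.
  by apply: integral0_eq => w _; rewrite restr01E (negbTE tI) expr0n.
rewrite int01_unif01 restr_moment//.
exact: measurable_fun_fubini_tonelli_G.
Qed.

Definition coupled_past (m : nat) (i : int) (k : nat + nat) : Om -> S :=
  match k with
  | inl k => delta (i - k%:Z)
  | inr k => deltac m i (i - k%:Z)
  end.

Definition splice (m k : nat) : nat + nat := if (k < m)%N then inl k else inr k.

Definition err01_approx (m : nat) (i : int) : Om * measurableTypeR R -> R :=
  shift_field f (coupled_past m i \o splice m).

Lemma splice_inj m : injective (splice m).
Proof. by move=> a b; rewrite /splice; do 2![case: ifP => _] => // -[]. Qed.

Lemma shift_proc_m_splice m i w :
  shift_proc_m delta deltac f m i w = f ((coupled_past m i \o splice m) ^~ w).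
Proof. by congr f; apply/funext => k; rewrite /= /splice; case: ifP. Qed.

Lemma iid_coupled_past m i : (0 < m)%N -> iid P (coupled_past m i).
Proof.
move=> m0; case: errP => _ /(_ m i m0) iidc _ _.
pose h (k : nat + nat) : int + int :=
  match k with inl k => inl (i - k%:Z) | inr k => inr (i - k%:Z) end.
have h_inj : injective h by move=> [a|a] [b|b] //= [ab]; congr (_ _); lia.
have := iid_reindex h_inj iidc; congr (iid P _).
by apply/funext => -[].
Qed.

Lemma eq_law_coupled_past m i k j : (0 < m)%N ->
  eq_law P (coupled_past m i k) P (delta j).
Proof.
move=> m0; apply: (@eq_law_trans _ _ _ _ _ _ _ _ _ P _ P (delta i) P).
  have := iid_eq_marginal k (inl 0%N) (iid_coupled_past i m0).
  by rewrite /= subr0.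
exact: iid_eq_marginal.
Qed.

Lemma L2sqnorm_err01_stationary i : L2sqnorm Q (err i) = L2sqnorm Q (err 0).
Proof.
apply: (L2dot_shift_field_law mf (iid_past i) (iid_past 0) _ id id) => k.
exact: iid_eq_marginal iid_delta.
Qed.

Lemma Lfun2_err01 i : err i \in Lfun2 Q.
Proof.
apply: (Lfun2_shift_field_law mf (iid_past i) (iid_past 0) _ (h := id)) => [k|].
  exact: iid_eq_marginal iid_delta.
exact: Lfun2_err01_0.
Qed.

Lemma Lfun2_err01_approx m i : (0 < m)%N -> err01_approx m i \in Lfun2 Q.
Proof.
move=> m0; have iidW := iid_reindex (@splice_inj m) (iid_coupled_past i m0).
apply: (Lfun2_shift_field_law mf iidW (iid_past 0) _ (h := id)) => [k|].
  exact: eq_law_coupled_past.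
exact: Lfun2_err01_0.
Qed.

Definition approx_error (m : nat) (i : int) : Om * measurableTypeR R -> R :=
  err i - err01_approx m i.

Lemma Lfun2_approx_error m i : (0 < m)%N -> approx_error m i \in Lfun2 Q.
Proof. by move=> m0; rewrite rpredB ?Lfun2_err01 ?Lfun2_err01_approx. Qed.

Lemma L2sqnorm_approx_error_stationary m i : (0 < m)%N ->
  L2sqnorm Q (approx_error m i) = L2sqnorm Q (approx_error m 0).
Proof.
move=> m0; have eqW k : eq_law P (coupled_past m i k) P (coupled_past m 0 k).
  apply: eq_law_trans (eq_law_coupled_past i k 0 m0) _.
  exact: eq_law_sym (eq_law_coupled_past 0 k 0 m0).
have dotE := L2dot_shift_field_law mf (iid_coupled_past i m0)
  (iid_coupled_past 0 m0) eqW.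
rewrite /approx_error !L2sqnormB ?Lfun2_err01 ?Lfun2_err01_approx//.
congr (_ - 2 * _ + _).
- exact: dotE inl inl.
- exact: dotE inl (splice m).
- exact: dotE (splice m) (splice m).
Qed.

(* Seen from time i + m, the innovations of eps_i have age at least m, whereas
   eps_{i+m,m} keeps only the original innovations of age less than m. *)
Lemma L2dot_err01_approx_eq0 m i : (0 < m)%N ->
  L2dot Q (err i) (err01_approx m (i + m%:Z)) = 0.
Proof.
move=> m0; set j := i + m%:Z.
have -> : err i = shift_field f (coupled_past m j \o (inl \o addn m)).
  congr (shift_field f _); apply/funext => k; rewrite /= /j.
  by congr delta; lia.
apply: (L2dot_shift_field_disjoint mf (iid_past 0) (iid_coupled_past j m0)).
- by move=> k l; exact: eq_law_coupled_past.
- exact: Lfun2_err01_0.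
- by case: errP => _ _ _ [_ mean0 _] g /mean0.
- by move=> a b [] /addnI.
- exact: splice_inj.
- move=> a b; rewrite /splice; case: ifP => //= bm.
  by apply/eqP => -[ab]; rewrite -ab ltnNge leq_addr in bm.
Qed.

Lemma L2dot_err01_le i k :
  `|L2dot Q (err i) (err (i + k.+1%:Z))| <=
  L2norm Q (err 0) * L2norm Q (approx_error k.+1 0).
Proof.
set j := i + k.+1%:Z.
have -> : L2dot Q (err i) (err j) = L2dot Q (err i) (approx_error k.+1 j).
  rewrite L2dotC -(subrK (err01_approx k.+1 j) (err j)).
  rewrite L2dotDl ?Lfun2_approx_error ?Lfun2_err01_approx ?Lfun2_err01//.
  rewrite (L2dotC _ (err01_approx _ _)) L2dot_err01_approx_eq0// addr0.
  exact: L2dotC.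
rewrite /L2norm -(L2sqnorm_err01_stationary i).
rewrite -(L2sqnorm_approx_error_stationary j)//.
by apply: L2dot_CauchySchwarz; [exact: Lfun2_err01|exact: Lfun2_approx_error].
Qed.

Lemma L2norm_approx_error m : (0 < m)%N ->
  sqrte (\int[P]_w int01 (fun t =>
    ((shift_proc delta f 0 w t - shift_proc_m delta deltac f m 0 w t) ^+ 2)%:E)) =
  (L2norm Q (approx_error m 0))%:E.
Proof.
move=> m0; rewrite -[RHS]/(sqrte _%:E) -integral_L2sqnorm_section; last first.
  exact: Lfun2_approx_error.
congr sqrte; apply: eq_integral => w _.
set g := shift_proc delta f 0 w - f ((coupled_past m 0 \o splice m) ^~ w).
have g2 : restr01 g \in Lfun2 unif01.
  by rewrite restr01B; apply: rpredB; apply: Lfun2_restr01; exact: mf.2.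
rewrite shift_proc_m_splice [LHS](int01_sqr_L2sqnorm g2).
rewrite -integral_sqr_L2sqnorm//.
by apply: eq_integral => t _; rewrite restr01B.
Qed.

Lemma L2norm_approx_error_sum_bounded :
  exists C, forall n, \sum_(k < n) L2norm Q (approx_error k.+1 0) <= C.
Proof.
case: errP => _ _ _ [/(_ 0) + _ _].
set u := (u in (\sum_(1 <= m <oo) u m)%E) => uoo.
have u0 m : (0 <= u m)%E by exact: sqrte_ge0.
exists (fine (\sum_(1 <= m <oo) u m)%E) => n.
rewrite -lee_fin fineK; last first.
  by rewrite ge0_fin_numE//; apply: nneseries_ge0 => m _ _; exact: u0.
apply: le_trans (nneseries_lim_ge n.+1 (fun m _ _ => u0 m)).
rewrite big_add1 /= big_mkord -sumEFin.
by apply: lee_sum => k _; rewrite -L2norm_approx_error.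
Qed.

Lemma L2sqnorm_err01_sum_le : exists C, forall N,
  L2sqnorm Q (\sum_(i < N) err i.+1%:Z) <= N%:R * C.
Proof.
have [A sumA] := L2norm_approx_error_sum_bounded.
exists (L2sqnorm Q (err 0) + 2 * (L2norm Q (err 0) * A)) => N.
apply: (L2sqnorm_sum_le (x := fun i => err i.+1%:Z)) => [i|i|i k|n].
- exact: Lfun2_err01.
- by rewrite L2sqnorm_err01_stationary.
- have := L2dot_err01_le i.+1%:Z k.
  by rewrite (_ : i.+1%:Z + _ = (i + k).+2%:Z)//; lia.
- by rewrite -mulr_sumr ler_wpM2l ?sqrtr_ge0.
Qed.

Definition err01_mean (N : nat) : Om * measurableTypeR R -> R :=
  N%:R^-1 *: \sum_(i < N) err i.+1%:Z.

Lemma Lfun2_err01_mean N : err01_mean N \in Lfun2 Q.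
Proof. by rewrite rpredZ ?rpred_sum// => i _; exact: Lfun2_err01. Qed.

Lemma L2sqnorm_err01_mean_le : exists C, forall N, (0 < N)%N ->
  L2sqnorm Q (err01_mean N) <= C / N%:R.
Proof.
have [C sumC] := L2sqnorm_err01_sum_le; exists C => N N0.
rewrite L2sqnormZ ?rpred_sum//; last by move=> i _; exact: Lfun2_err01.
rewrite (_ : C / N%:R = N%:R^-1 ^+ 2 * (N%:R * C)).
  by apply: ler_wpM2l; [exact: sqr_ge0|exact: sumC].
by field; rewrite pnatr_eq0 -lt0n.
Qed.

Lemma cvg_L2sqnorm_err01_mean (k : nat -> nat) : k @ \oo --> \oo ->
  L2sqnorm Q (err01_mean (k n)) @[n --> \oo] --> (0 : R).
Proof.
move=> koo; have [C meanC] := L2sqnorm_err01_mean_le.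
have k_gt0 : \forall n \near \oo, (0 < k n)%N by move/cvgnyPgt : koo; apply.
apply: (@squeeze_cvgr _ _ _ _ (cst 0) (fun n => C * (k n)%:R^-1)).
- by apply: filterS k_gt0 => n k0; rewrite L2sqnorm_ge0 meanC.
- exact: cvg_cst.
rewrite -[X in _ --> X](mulr0 C); apply: cvgM; first exact: cvg_cst.
exact: cvg_natr_inv.
Qed.

End error_process.

(** * Two samples *)

Section sample_mean.
Context {d dS : measure_display} {Om : measurableType d} {S : measurableType dS}
  {R : realType} (delta : int -> Om -> S) (f : (nat -> S) -> R -> R).

Lemma err01_mean_section N w : (fun t => err01_mean delta f N (w, t)) =
  N%:R^-1 *: \sum_(i < N) restr01 (shift_proc delta f i.+1%:Z w).
Proof. by apply/funext => t; rewrite /err01_mean !fctE !fct_sumE. Qed.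

Lemma Lfun2_err01_mean_section N w : (forall s, L2fun (f s)) ->
  (fun t => err01_mean delta f N (w, t)) \in Lfun2 unif01.
Proof.
move=> f2; rewrite err01_mean_section; apply: rpredZ; apply: rpred_sum => i _.
by apply: Lfun2_restr01; exact: f2.
Qed.

Lemma restr01_sample_mean mu N w : (0 < N)%N ->
  restr01 (sample_mean mu (shift_proc delta f) N w) =
  restr01 mu + (fun t => err01_mean delta f N (w, t)).
Proof.
move=> N0; rewrite err01_mean_section -restr01_sum -restr01Z -restr01D.
congr restr01; apply/funext => t; rewrite /sample_mean !fctE fct_sumE.
rewrite big_add1 big_mkord big_split mulrDr sumr_const card_ord.
by rewrite -[mu t *+ N]mulr_natl mulKf ?pnatr_eq0 -?lt0n.
Qed.

End sample_mean.

Section two_sample_means.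
Context {d dS dS' : measure_display} {Om : measurableType d}
  {S : measurableType dS} {S' : measurableType dS'} {R : realType}
  (P : probability Om R).
Variables (delta : int -> Om -> S) (deltac : nat -> int -> int -> Om -> S)
  (f : (nat -> S) -> R -> R) (delta' : int -> Om -> S')
  (deltac' : nat -> int -> int -> Om -> S') (f' : (nat -> S') -> R -> R)
  (mu mu' : R -> R).
Hypotheses (L2mu : L2fun mu) (L2mu' : L2fun mu').
Hypotheses (errP : error_assumptions P delta deltac f)
  (errP' : error_assumptions P delta' deltac' f').

Let signal : R -> R := restr01 (mu - mu').

Let noise (N M : nat) : Om * measurableTypeR R -> R :=
  err01_mean delta f N - err01_mean delta' f' M.

Definition mean_sqdist (N M : nat) (w : Om) : R :=
  L2sqnorm unif01 (signal + (fun t => noise N M (w, t))).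

Let Lfun2_signal : signal \in Lfun2 unif01.
Proof. by rewrite /signal restr01B; apply: rpredB; exact: Lfun2_restr01. Qed.

Let Lfun2_noise N M : noise N M \in Lfun2 (P \x unif01)%E.
Proof.
exact: rpredB (Lfun2_err01_mean errP N) (Lfun2_err01_mean errP' M).
Qed.

Let Lfun2_noise_section N M w : (fun t => noise N M (w, t)) \in Lfun2 unif01.
Proof.
have [_ _ [_ f2] _] := errP; have [_ _ [_ f2'] _] := errP'.
exact: rpredB (Lfun2_err01_mean_section delta N w f2)
  (Lfun2_err01_mean_section delta' M w f2').
Qed.

Lemma int01_mean_diff :
  int01 (fun t => ((mu t - mu' t) ^+ 2)%:E) = (L2sqnorm unif01 signal)%:E.
Proof. exact: (int01_sqr_L2sqnorm Lfun2_signal). Qed.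

Lemma int01_sample_mean_diff N M w : (0 < N)%N -> (0 < M)%N ->
  int01 (fun t => ((sample_mean mu (shift_proc delta f) N w t
    - sample_mean mu' (shift_proc delta' f') M w t) ^+ 2)%:E) =
  (mean_sqdist N M w)%:E.
Proof.
move=> N0 M0; pose g := sample_mean mu (shift_proc delta f) N w
  - sample_mean mu' (shift_proc delta' f') M w.
have gE : restr01 g = signal + (fun t => noise N M (w, t)).
  by rewrite /signal !restr01B !restr01_sample_mean// opprD addrACA.
have g2 : restr01 g \in Lfun2 unif01 by rewrite gE; apply: rpredD.
by rewrite [LHS](int01_sqr_L2sqnorm g2) gE.
Qed.

Lemma measurable_mean_sqdist N M : measurable_fun setT (mean_sqdist N M).
Proof.
apply: (measurable_L2sqnorm_section unif01
  (z := fun p => signal p.2 + noise N M p)).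
apply: measurable_funD; last exact: Lfun2_measurable (Lfun2_noise N M).
exact: (measurableT_comp (Lfun2_measurable Lfun2_signal) measurable_snd).
Qed.

Lemma cvg_in_measure_mean_sqdist (Nn Mn : nat -> nat) :
  Nn @ \oo --> \oo -> Mn @ \oo --> \oo ->
  cvg_in_measure P (fun n => mean_sqdist (Nn n) (Mn n))
    (L2sqnorm unif01 signal).
Proof.
move=> Noo Moo; pose x n := err01_mean delta f (Nn n).
pose y n := err01_mean delta' f' (Mn n); pose Q := (P \x unif01)%E.
have x0 := cvg_L2sqnorm_err01_mean errP Noo.
have y0 := cvg_L2sqnorm_err01_mean errP' Moo.
apply: (cvg_in_measure_L2sqnormD (z := fun n => noise (Nn n) (Mn n))
  Lfun2_signal (fun n => Lfun2_noise _ _) (fun n => Lfun2_noise_section _ _)).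
apply: (@squeeze_cvgr _ _ _ _ (cst 0) (fun n =>
    2 * (L2sqnorm Q (x n) + L2sqnorm Q (y n)))).
- apply: nearW => n; rewrite L2sqnorm_ge0/=.
  exact: L2sqnormB_le (Lfun2_err01_mean errP _) (Lfun2_err01_mean errP' _).
- exact: cvg_cst.
- rewrite (_ : 0 = 2 * (0 + 0)); last by rewrite addr0 mulr0.
  by apply: cvgM; [exact: cvg_cst|exact: cvgD].
Qed.

End two_sample_means.

Theorem theorem4 (R : realType) (d : measure_display) (Om : measurableType d)
  (P : probability Om R)
  (dS : measure_display) (S : measurableType dS) (delta : int -> Om -> S)
  (deltac : nat -> int -> int -> Om -> S) (f : (nat -> S) -> R -> R)
  (dS' : measure_display) (S' : measurableType dS') (delta' : int -> Om -> S')
  (deltac' : nat -> int -> int -> Om -> S') (f' : (nat -> S') -> R -> R)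
  (mu mu' : R -> R) (theta : R) (Nn Mn : nat -> nat) :
  L2fun mu -> L2fun mu' ->
  error_assumptions P delta deltac f ->
  error_assumptions P delta' deltac' f' ->
  indep_families P
    (fun p : nat * L2sub R => fun w => ip01 (shift_proc delta f p.1.+1%:Z w) (sval p.2))
    (fun p : nat * L2sub R => fun w => ip01 (shift_proc delta' f' p.1.+1%:Z w) (sval p.2)) ->
  (0 < int01 (fun t => ((mu t - mu' t) ^+ 2)%:E))%E ->
  0 <= theta <= 1 ->
  (forall K : nat, \forall n \near \oo, (K <= minn (Nn n) (Mn n))%N) ->
  ((fun n => (Nn n)%:R / (Nn n + Mn n)%:R : R) @ \oo --> theta) ->
  let U n w := (((Nn n * Mn n)%:R / (Nn n + Mn n)%:R)%:E *
      int01 (fun t => ((sample_mean mu (shift_proc delta f) (Nn n) w t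
                        - sample_mean mu' (shift_proc delta' f') (Mn n) w t) ^+ 2)%:E))%E in
  (forall e : R, 0 < e ->
     (fun n => P [set w | (e%:E < `| ((Nn n + Mn n)%:R / (Nn n * Mn n)%:R)%:E * U n w
                              - int01 (fun t => ((mu t - mu' t) ^+ 2)%:E) |)%E])
     @ \oo --> 0%E) /\
  (0 < theta < 1 ->
   forall K : R, (fun n => P [set w | (U n w <= K%:E)%E]) @ \oo --> 0%E).
Proof.
move=> L2mu L2mu' errP errP' _ signal_gt0 _ /cvg_minn_infty[Noo Moo] _ U.
pose dist n := mean_sqdist delta f delta' f' mu mu' (Nn n) (Mn n).
pose scale n : R := (Nn n * Mn n)%:R / (Nn n + Mn n)%:R.
have scaleoo : scale @ \oo --> +oo := cvg_half_harmonic_mean_pinfty Noo Moo.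
have NM_gt0 : \forall n \near \oo, (0 < Nn n)%N /\ (0 < Mn n)%N.
  by apply: filterI; [move/cvgnyPgt : Noo|move/cvgnyPgt : Moo]; apply.
have UE : \forall n \near \oo,
    scale n != 0 /\ forall w, U n w = (scale n * dist n w)%:E.
  apply: filterS NM_gt0 => n [N0 M0]; split=> [|w].
    by rewrite mulf_neq0// ?invr_eq0 pnatr_eq0 -lt0n ?muln_gt0 ?addn_gt0 N0.
  by rewrite /U (int01_sample_mean_diff L2mu L2mu' errP errP').
have dist_cvg := cvg_in_measure_mean_sqdist L2mu L2mu' errP errP' Noo Moo.
rewrite (int01_mean_diff L2mu L2mu') in signal_gt0 *; split=> [e e0|_ K].
  apply: cvg_trans (dist_cvg e e0); apply: near_eq_cvg.
  apply: filterS UE => n [scale0 UnE]; congr (P _); apply/funext => w /=.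
  by rewrite UnE -invf_div -EFinM mulKf// -EFinB lte_fin.
have mdist n := measurable_mean_sqdist L2mu L2mu' errP errP' (Nn n) (Mn n).
apply: cvg_trans
  (cvg_in_measure_scale_pinfty mdist dist_cvg signal_gt0 scaleoo K).
apply: near_eq_cvg; apply: filterS UE => n [_ UnE].
by congr (P _); apply/funext => w /=; rewrite UnE lee_fin.
Qed.
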